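(* Let $K$ be a field with at least $4$ elements and let $S$ be a smooth cubic surface over $K$. Suppose $S$ contains a skew pair of lines $\ell,\ell'$, both defined over $K$. Let $P$ be any $K$-rational point on $\ell$ or on $\ell'$ that is not an Eckardt point. Then $\mathrm{Span}(P)=S(K)$.
   Context: A smooth cubic surface $S$ over $K$ is a nonsingular surface in $\mathbb{P}^3$ defined by a homogeneous cubic polynomial $F\in K[x_0,x_1,x_2,x_3]$. A $K$-line is a line in $\mathbb{P}^3$ defined over $K$. A line ''on $S$'' means a line over $\overline{K}$ contained in $S$ (there are 27 of them). A skew pair of lines is a pair of disjoint lines. An Eckardt point is a point of $S$ through which three of the lines on $S$ pass. Secant and tangent process: if $\ell$ is a line not contained in $S$, then $\ell\cdot S=P+Q+R$ (points counted with multiplicity). For $B\subseteq S(K)$ define $B_0=B$ and $B_{n+1}$ as the set of $R\in S(K)$ such that either $R\in B_n$ or there exist $P,Q\in B_n$ and a $K$-line $\ell\not\subset S$ with $\ell\cdot S=P+Q+R$. Then $\mathrm{Span}(B)=\bigcup_{n\ge0}B_n$, and $\mathrm{Span}(P)=\mathrm{Span}(\{P\})$. *)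

(* Defs.v *)
From HB Require Import structures.
From mathcomp Require Import all_boot all_order all_algebra.
Set Implicit Arguments. Unset Strict Implicit. Unset Printing Implicit Defensive.
Import Order.TTheory GRing.Theory Num.Theory.
Local Open Scope ring_scope.

(* A cubic form in x_0..x_3 over a ring R is given by a coefficient tensor
   c : 'I_4 -> 'I_4 -> 'I_4 -> R, F(x) = sum_{i,j,k} c i j k x_i x_j x_k.
   Every homogeneous cubic in 4 variables has such a representation.
   Points of P^3 are represented by nonzero row vectors 'rV_4. *)
Definition cubic (R : Type) := 'I_4 -> 'I_4 -> 'I_4 -> R.

Definition cubic_eval (R : comNzRingType) (F : cubic R) (x : 'rV[R]_4) : R :=
  \sum_(i < 4) \sum_(j < 4) \sum_(k < 4) F i j k * x 0 i * x 0 j * x 0 k.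

Definition cubic_partial (R : comNzRingType) (F : cubic R) (l : 'I_4)
    (x : 'rV[R]_4) : R :=
  \sum_(i < 4) \sum_(j < 4) \sum_(k < 4)
     F i j k * ((i == l)%:R * x 0 j * x 0 k + x 0 i * (j == l)%:R * x 0 k
                + x 0 i * x 0 j * (k == l)%:R).

Definition cubic_map (K L : fieldType) (f : {rmorphism K -> L}) (F : cubic K)
  : cubic L := fun i j k => f (F i j k).

Definition smooth_cubic (K : fieldType) (F : cubic K) : Prop :=
  forall (L : closedFieldType) (f : {rmorphism K -> L}) (x : 'rV[L]_4),
    cubic_eval (cubic_map f F) x = 0 ->
    (forall l, cubic_partial (cubic_map f F) l x = 0) -> x = 0.

(* A line of P^3 over a field is the projectivisation of the row space of a
   rank-2 matrix M : 'M_(2,4); its points are w *m M, w : 'rV_2 nonzero. *)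
Definition line_on (L : fieldType) (F : cubic L) (M : 'M[L]_(2, 4)) : Prop :=
  \rank M = 2%N /\ forall w : 'rV[L]_2, cubic_eval F (w *m M) = 0.

Definition eckardt (K : fieldType) (F : cubic K) (P : 'rV[K]_4) : Prop :=
  cubic_eval F P = 0 /\
  exists (L : closedFieldType) (f : {rmorphism K -> L}) (M1 M2 M3 : 'M[L]_(2, 4)),
    [/\ line_on (cubic_map f F) M1, line_on (cubic_map f F) M2,
        line_on (cubic_map f F) M3,
        [/\ (map_mx f P <= M1)%MS, (map_mx f P <= M2)%MS & (map_mx f P <= M3)%MS]
      & [/\ ~~ (M1 == M2)%MS, ~~ (M1 == M3)%MS & ~~ (M2 == M3)%MS]].

(* binary linear form vanishing exactly at the point p of P^1 *)
Definition lin2 (K : fieldType) (p w : 'rV[K]_2) : K :=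
  p 0 1 * w 0 0 - p 0 0 * w 0 1.

(* secant/tangent relation: a K-line l (row space of M), not contained in S,
   with l . S = P + Q + R (as divisors on l ~ P^1), P, Q, R in S(K). *)
Definition secant (K : fieldType) (F : cubic K) (P Q R : 'rV[K]_4) : Prop :=
  [/\ P != 0, Q != 0 & R != 0] /\
  exists (M : 'M[K]_(2, 4)) (p q r : 'rV[K]_2) (c : K),
    [/\ \rank M = 2%N, [/\ P = p *m M, Q = q *m M & R = r *m M],
        c != 0 &
        forall w : 'rV[K]_2,
          cubic_eval F (w *m M) = c * lin2 p w * lin2 q w * lin2 r w].

Inductive Span (K : fieldType) (F : cubic K) (B : 'rV[K]_4 -> Prop)
  : 'rV[K]_4 -> Prop :=
| Span_base x : B x -> Span F B x
| Span_step P Q R : Span F B P -> Span F B Q -> secant F P Q R -> Span F B R.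

(* Span(P) = Span({P}); {P} as the set of all representatives of P *)
Definition SpanPt (K : fieldType) (F : cubic K) (P : 'rV[K]_4) :
  'rV[K]_4 -> Prop :=
  Span F (fun x => exists2 a : K, a != 0 & x = a *: P).

(* Main.v *)
(* Let the residual conic of a line l of S in the tangent plane at a point p of l meet
   l in p and p'. If p <> p' the plane section has equation z (xy + c z^2) with
   p = (1,0,0), p' = (0,1,0), l : z = 0. Tangents at p sweep out the conic, or the side
   opposite to p of the triangle when c = 0, and chords of the conic cover l minus
   {p, p'}. These two points are recovered from the tangent plane at another
   unramified point of l, which exists as soon as K has four elements: so l is
   generated, and so are all sides of the triangle. If p = p' and the conic is smooth,
   its chords and tangents cover l; if it is singular, p is an Eckardt point.

   For skew lines l, l' put A(u,w) = D_w F(u) and B(u,w) = D_u F(w) for u on l, w on l'.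
   Then F(su + tw) = st (s A + t B), so any point of S on a transversal not contained in
   S is collinear with points of l and l', and the transversals contained in S are
   sides of tangent triangles. So S(K) is generated as soon as a skew pair is. After l
   has been generated, a smooth residual conic gives a non-Eckardt point of l', hence
   l'; if all residual conics are singular, two of them contain transversals which form
   a generated skew pair. *)
Require Import Defs.
From HB Require Import structures.
From mathcomp Require Import all_boot all_order all_algebra.
From mathcomp Require Import closed_field.
From mathcomp Require Import boolp classical_sets filter.
From mathcomp Require Import ring.
Set Implicit Arguments. Unset Strict Implicit. Unset Printing Implicit Defensive.
Import GRing.Theory.
Local Open Scope ring_scope.

(** * An algebraically closed extension of an arbitrary field *)

Section Ultraproduct.
Variables (I : Type) (L : I -> closedFieldType) (U : set_system I).
Hypothesis ultraU : UltraFilter U.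

Let fam := forall i, L i.

Definition ueq (f g : fam) : Prop := U [set i | f i = g i]%classic.

(** Elements are the equivalence classes themselves, as predicates. The proof of [UltraFilter U] is
    an argument of the type so that the field structure, which depends on it, can be attached to the
    type. *)
Definition ultraproduct_of of UltraFilter U := {C : fam -> Prop | exists f, C = ueq f}.
Definition ultraproduct := ultraproduct_of ultraU.
HB.instance Definition _ := gen_eqMixin ultraproduct.
HB.instance Definition _ := gen_choiceMixin ultraproduct.
Let Q := ultraproduct.

Definition upi (f : fam) : Q := exist _ (ueq f) (ex_intro _ f erefl).
Definition urepr (q : Q) : fam := projT1 (cid (projT2 q)).

Lemma ueqP f g : upi f = upi g <-> ueq f g.
Proof.
split=> [[] fg | fg].
  by rewrite fg; apply: filterS filterT => i _.
have E : ueq f = ueq g.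
  apply/funext => h; apply/propext; split => H; move: fg H; apply: filterS2.
    by move=> i /= -> .
  by move=> i /= -> .
rewrite /upi; move: (ex_intro _ g _); rewrite -E => p.
by congr exist; exact: Prop_irrelevance.
Qed.

Lemma ureprK q : upi (urepr q) = q.
Proof.
case: q => C HC; rewrite /urepr /=; case: (cid _) => f /= E; subst C.
by congr exist; exact: Prop_irrelevance.
Qed.

Lemma upiK f : U [set i | urepr (upi f) i = f i]%classic.
Proof. by apply/ueqP; rewrite ureprK. Qed.

Lemma upi_surj q : exists f, q = upi f.
Proof. by exists (urepr q); rewrite ureprK. Qed.

Let uop2 (op : forall i, L i -> L i -> L i) (x y : Q) : Q :=
  upi (fun i => op i (urepr x i) (urepr y i)).
Let uop1 (op : forall i, L i -> L i) (x : Q) : Q := upi (fun i => op i (urepr x i)).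

Let uop2E op f g : uop2 op (upi f) (upi g) = upi (fun i => op i (f i) (g i)).
Proof. by apply/ueqP; apply: filterS2 (upiK f) (upiK g) => i /= -> ->. Qed.
Let uop1E op f : uop1 op (upi f) = upi (fun i => op i (f i)).
Proof. by apply/ueqP; apply: filterS (upiK f) => i /= ->. Qed.

Definition uadd := uop2 (fun i => +%R).
Definition umul := uop2 (fun i => *%R).
Definition uopp := uop1 (fun i => -%R).
Definition uinv := uop1 (fun i => @GRing.inv (L i)).
Definition uzero := upi (fun i => 0).
Definition uone := upi (fun i => 1).

Lemma uaddE f g : uadd (upi f) (upi g) = upi (fun i => f i + g i).
Proof. exact: uop2E. Qed.
Lemma umulE f g : umul (upi f) (upi g) = upi (fun i => f i * g i).
Proof. exact: uop2E. Qed.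
Lemma uoppE f : uopp (upi f) = upi (fun i => - f i).
Proof. exact: uop1E. Qed.
Lemma uinvE f : uinv (upi f) = upi (fun i => (f i)^-1).
Proof. exact: uop1E. Qed.

Lemma eq_upi f g : (forall i, f i = g i) -> upi f = upi g.
Proof. by move=> E; apply/ueqP; apply: filterS filterT => i _ /=. Qed.

Ltac ustep := repeat (let q := fresh "q" in move=> q; have [? ->] := upi_surj q);
  rewrite /uzero /uone ?(uaddE, umulE, uoppE); apply: eq_upi => i.

Lemma uaddA : associative uadd. Proof. by ustep; rewrite addrA. Qed.
Lemma uaddC : commutative uadd. Proof. by ustep; rewrite addrC. Qed.
Lemma uadd0 : left_id uzero uadd. Proof. by ustep; rewrite add0r. Qed.
Lemma uaddN : left_inverse uzero uopp uadd. Proof. by ustep; rewrite addNr. Qed.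
Lemma umulA : associative umul. Proof. by ustep; rewrite mulrA. Qed.
Lemma umulC : commutative umul. Proof. by ustep; rewrite mulrC. Qed.
Lemma umul1 : left_id uone umul. Proof. by ustep; rewrite mul1r. Qed.
Lemma umulD : left_distributive umul uadd. Proof. by ustep; rewrite mulrDl. Qed.
Lemma uone_neq0 : uone != uzero.
Proof.
apply/eqP => /ueqP E; have [i /= /eqP] := filter_ex E.
by rewrite oner_eq0.
Qed.

HB.instance Definition _ := GRing.isZmodule.Build ultraproduct uaddA uaddC uadd0 uaddN.
HB.instance Definition _ := GRing.Zmodule_isComNzRing.Build ultraproduct
  umulA umulC umul1 umulD uone_neq0.

Lemma uinv_axiom (x : ultraproduct) : x != 0 -> uinv x * x = 1.
Proof.
have [f ->] := upi_surj x => nz; rewrite uinvE; apply: etrans (umulE _ _) _.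
(* Maximality of the ultrafilter: either the zero set of [f] is large, and the class is zero, or its
   complement is, and the pointwise inverse works there. *)
apply/ueqP; case: (in_ultra_setVsetC [set i | f i = 0]%classic ultraU) => [Z|].
  by case/eqP: nz; apply/ueqP.
by apply: filterS => i /= /eqP fi; rewrite mulVf.
Qed.

Lemma uinv0 : uinv 0 = 0 :> ultraproduct.
Proof. by apply: etrans (uinvE _) _; apply: eq_upi => i; rewrite invr0. Qed.

HB.instance Definition _ := GRing.ComNzRing_isField.Build ultraproduct uinv_axiom uinv0.

Lemma upiX f n : upi f ^+ n = upi (fun i => f i ^+ n).
Proof.
elim: n => [|n IH]; first by rewrite expr0; apply: eq_upi => i; rewrite expr0.
by rewrite exprS IH; apply: etrans (umulE _ _) _; apply: eq_upi => i; rewrite exprS.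
Qed.

Lemma upi_sum n (f : 'I_n -> fam) :
  \sum_(k < n) upi (f k) = upi (fun i => \sum_(k < n) f k i).
Proof.
elim: n f => [|n IH] f.
  by rewrite big_ord0; apply: eq_upi => i; rewrite big_ord0.
rewrite big_ord_recl IH; apply: etrans (uaddE _ _) _; apply: eq_upi => i.
by rewrite big_ord_recl.
Qed.

(** A root is chosen in each factor; the class of these choices is a root, since ring operations are
    pointwise. *)
Lemma ultraproduct_closed : GRing.closed_field_axiom ultraproduct.
Proof.
move=> n P n0.
have E i : exists x : L i, x ^+ n = \sum_(k < n) urepr (P k) i * x ^+ k.
  exact: (@solve_monicpoly (L i) n (fun k => urepr (P k) i)).
exists (upi (fun i => projT1 (cid (E i)))).
rewrite upiX; under eq_bigr => k _.
  rewrite upiX -{1}(ureprK (P k)).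
  rewrite (umulE _ _ : upi _ * upi _ = _); over.
by rewrite upi_sum; apply: eq_upi => i; case: (cid _).
Qed.

HB.instance Definition _ := Field_isAlgClosed.Build ultraproduct ultraproduct_closed.

End Ultraproduct.

(** * Finitely generated subfields and their countability *)

Section GeneratedSubfield.
Variables (K : fieldType) (s : seq K).

(* Trees encode subtraction and division expressions in the entries of s. *)
Fixpoint gen_eval (t : GenTree.tree nat) : K :=
  match t with
  | GenTree.Leaf n => s`_n
  | GenTree.Node 0 [:: a; b] => gen_eval a - gen_eval b
  | GenTree.Node 1 [:: a; b] => gen_eval a / gen_eval b
  | _ => 1
  end.

Definition generated : {pred K} := fun x => `[< exists t, gen_eval t = x >].

Lemma generatedP x : reflect (exists t, gen_eval t = x) (x \in generated).
Proof. exact: asboolP. Qed.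

Lemma generated_closed : divring_closed generated.
Proof.
split.
- by apply/generatedP; exists (GenTree.Node 2 [::]).
- move=> x y /generatedP[t <-] /generatedP[u <-].
  by apply/generatedP; exists (GenTree.Node 0 [:: t; u]).
move=> x y /generatedP[t <-] /generatedP[u <-].
by apply/generatedP; exists (GenTree.Node 1 [:: t; u]).
Qed.

HB.instance Definition _ := GRing.isDivringClosed.Build K generated generated_closed.

Definition gen_subfield := {x | x \in generated}.
HB.instance Definition _ := SubChoice.on gen_subfield.
HB.instance Definition _ := [SubChoice_isSubIntegralDomain of gen_subfield by <:].
HB.instance Definition _ := [SubIntegralDomain_isSubField of gen_subfield by <:].

Definition gen_code (x : gen_subfield) : GenTree.tree nat :=
  projT1 (cid (elimT (generatedP _) (valP x))).
Definition gen_decode t : option gen_subfield := insub (gen_eval t).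

Lemma gen_codeK : pcancel gen_code gen_decode.
Proof.
by move=> x; rewrite /gen_decode /gen_code; case: (cid _) => t /= ->; rewrite valK.
Qed.

HB.instance Definition _ := PCanIsCountable gen_codeK.

Lemma mem_generated x : x \in s -> x \in generated.
Proof.
by move=> xs; apply/generatedP; exists (GenTree.Leaf (index x s)); rewrite /= nth_index.
Qed.

End GeneratedSubfield.

(* K embeds into an ultraproduct of algebraic closures of its finitely generated
   subfields, which are countable; only countable fields have a closure in mathcomp. *)
Lemma algebraically_closed_extension (K : fieldType) :
  exists L : closedFieldType, inhabited {rmorphism K -> L}.
Proof.
pose cl (s : seq K) := countable_algebraic_closure (gen_subfield s : countFieldType).
pose L (s : seq K) : closedFieldType := projT1 (cl s).
pose phi s : {rmorphism gen_subfield s -> L s} := sval (projT2 (cl s)).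
pose above (s : seq K) : set (seq K) := [set t : seq K | {subset s <= t}]%classic.
(* The cones of finite sequences containing a given one form a filter base; an ultrafilter above it
   sees any finite set of elements of [K] in almost every index. *)
have properF : ProperFilter (filter_from setT above).
  apply: filter_from_proper; last by move=> s _; exists s => /=.
  apply: filter_from_filter; first by exists [::].
  move=> s t _ _; exists (s ++ t) => // u sub; split=> x xs; apply: sub;
    by rewrite mem_cat xs ?orbT.
have [U [ultraU FU]] := ultraFilterLemma properF.
have near s : U (above s) by apply: FU; exists s.
(* The value 0 outside the subfield is a dummy: each [x] lies in almost all of the subfields. *)
pose emb s (x : K) : L s := if insub x is Some y then phi s y else 0.
have embE s (y : gen_subfield s) : emb s (val y) = phi s y by rewrite /emb valK.
pose psi (x : K) : ultraproduct L ultraU := upi ultraU (emb^~ x).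
have two x y s : above [:: x; y] s ->
    exists x' y' : gen_subfield s, x = val x' /\ y = val y'.
  move=> sub; have xs := mem_generated (sub x (mem_head _ _)).
  have ys : y \in generated s by apply/mem_generated/sub; rewrite !inE eqxx orbT.
  by exists (Sub x xs), (Sub y ys); rewrite !SubK.
have psiB : zmod_morphism psi.
  move=> x y; apply: esym; apply: etrans (congr1 _ (uoppE _ _)) _.
  apply: etrans (uaddE _ _ _) _; apply/ueqP; apply: filterS (near [:: x; y]) => s.
  by move=> /two[x' [y' [-> ->]]] /=; rewrite (_ : val x' - val y' = val (x' - y')) // !embE rmorphB.
have psiM : monoid_morphism psi.
  split.
    by apply: eq_upi => s; rewrite (_ : 1 = val (1 : gen_subfield s)) // embE rmorph1.
  move=> x y; apply: esym; apply: etrans (umulE _ _ _) _.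
  apply/ueqP; apply: filterS (near [:: x; y]) => s.
  by move=> /two[x' [y' [-> ->]]] /=; rewrite (_ : val x' * val y' = val (x' * y')) // !embE rmorphM.
exists (ultraproduct L ultraU); constructor.
exact: (HB.pack_for {rmorphism K -> ultraproduct L ultraU} psi
  (GRing.isZmodMorphism.Build _ _ psi psiB) (GRing.isMonoidMorphism.Build _ _ psi psiM)).
Qed.

(** * Polarization of a cubic form *)

Section Polarization.
Variables (R : comNzRingType) (F : cubic R).
Implicit Types (u v w : 'rV[R]_4) (x y z : R).

Definition trilinear u v w : R :=
  \sum_(i < 4) \sum_(j < 4) \sum_(k < 4) F i j k * u 0 i * v 0 j * w 0 k.

Let triE u v w : trilinear u v w =
  \sum_(p : 'I_4 * 'I_4 * 'I_4) F p.1.1 p.1.2 p.2 * u 0 p.1.1 * v 0 p.1.2 * w 0 p.2.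
Proof. by rewrite /trilinear pair_bigA /= pair_bigA. Qed.

Let tri1 x y u1 u2 v w : trilinear (x *: u1 + y *: u2) v w =
  x * trilinear u1 v w + y * trilinear u2 v w.
Proof.
rewrite !triE !mulr_sumr -big_split; apply: eq_bigr => p _ /=; rewrite !mxE; ring.
Qed.
Let tri2 x y u v1 v2 w : trilinear u (x *: v1 + y *: v2) w =
  x * trilinear u v1 w + y * trilinear u v2 w.
Proof.
rewrite !triE !mulr_sumr -big_split; apply: eq_bigr => p _ /=; rewrite !mxE; ring.
Qed.
Let tri3 x y u v w1 w2 : trilinear u v (x *: w1 + y *: w2) =
  x * trilinear u v w1 + y * trilinear u v w2.
Proof.
rewrite !triE !mulr_sumr -big_split; apply: eq_bigr => p _ /=; rewrite !mxE; ring.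
Qed.

(* [dF u v] is the derivative of F at u in the direction v; together with [polar] it gives
   the expansion of F on a plane without dividing by 2 or 3. *)
Definition dF u v := trilinear v u u + trilinear u v u + trilinear u u v.

Definition polar u v w :=
  trilinear u v w + trilinear u w v + trilinear v u w +
  trilinear v w u + trilinear w u v + trilinear w v u.

Lemma dF_lin u v w x y : dF u (x *: v + y *: w) = x * dF u v + y * dF u w.
Proof. by rewrite /dF tri1 tri2 tri3; ring. Qed.

Lemma dF_quad u v w x y : dF (x *: u + y *: v) w =
  x ^+ 2 * dF u w + x * y * polar u v w + y ^+ 2 * dF v w.
Proof. by rewrite /dF /polar !(tri1, tri2, tri3); ring. Qed.

Lemma polarC u v w : polar u v w = polar v u w.
Proof. by rewrite /polar; ring. Qed.

Lemma polar_rot u v w : polar u v w = polar v w u.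
Proof. by rewrite /polar; ring. Qed.

Lemma polar_lin u v w1 w2 x y :
  polar u v (x *: w1 + y *: w2) = x * polar u v w1 + y * polar u v w2.
Proof. by rewrite /polar !(tri1, tri2, tri3); ring. Qed.

Lemma polarCA u v w : polar u v w = polar u w v.
Proof. by rewrite /polar; ring. Qed.

Lemma polar_l u v : polar u v u = dF u v *+ 2.
Proof. by rewrite /polar /dF; ring. Qed.

Lemma polar_r u v : polar u v v = dF v u *+ 2.
Proof. by rewrite /polar /dF; ring. Qed.

Lemma polar_quad u v w x y z t : polar (x *: u + y *: v) (z *: u + t *: v) w =
  (x * z * dF u w + y * t * dF v w) *+ 2 + (x * t + y * z) * polar u v w.
Proof. by rewrite /polar /dF !(tri1, tri2, tri3); ring. Qed.

Lemma dF_lin3 u a b c x y z : dF u (x *: a + y *: b + z *: c) =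
  x * dF u a + y * dF u b + z * dF u c.
Proof. by rewrite -[x *: a + _]scale1r !dF_lin; ring. Qed.

Lemma polar_lin3 u v a b c x y z : polar u v (x *: a + y *: b + z *: c) =
  x * polar u v a + y * polar u v b + z * polar u v c.
Proof. by rewrite -[x *: a + _]scale1r !polar_lin; ring. Qed.

Lemma dF_quad3 a b c u x y z : dF (x *: a + y *: b + z *: c) u =
  x ^+ 2 * dF a u + y ^+ 2 * dF b u + z ^+ 2 * dF c u +
  x * y * polar a b u + x * z * polar a c u + y * z * polar b c u.
Proof.
by rewrite -[x *: a + _]scale1r /dF /polar !(tri1, tri2, tri3); ring.
Qed.

Lemma polar0 u v : polar u v 0 = 0.
Proof. by have := polar_lin u v 0 0 0 0; rewrite scale0r addr0 !mul0r addr0. Qed.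

Lemma dF0 u : dF u 0 = 0.
Proof. by have := dF_lin u 0 0 0 0; rewrite !scale0r addr0 !mul0r addr0. Qed.

Lemma dFZl u v x : dF (x *: u) v = x ^+ 2 * dF u v.
Proof. by have := dF_quad u 0 v x 0; rewrite scale0r addr0 => ->; ring. Qed.

Lemma dFZr u v x : dF u (x *: v) = x * dF u v.
Proof. by have := dF_lin u v 0 x 0; rewrite scale0r addr0 => ->; ring. Qed.

Lemma polarZ u v w x : polar u (x *: v) w = x * polar u v w.
Proof.
rewrite polarCA [in RHS]polarCA; have := polar_lin u w v 0 x 0.
by rewrite scale0r addr0 => ->; ring.
Qed.

Lemma dF_id u : dF u u = cubic_eval F u *+ 3.
Proof. by rewrite /dF -[cubic_eval F u]/(trilinear u u u); ring. Qed.

Lemma cubic_eval2 u v x y : cubic_eval F (x *: u + y *: v) =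
  x ^+ 3 * cubic_eval F u + x ^+ 2 * y * dF u v + x * y ^+ 2 * dF v u +
  y ^+ 3 * cubic_eval F v.
Proof.
rewrite /dF -!/(trilinear _ _ _) -[cubic_eval F _]/(trilinear _ _ _).
rewrite -[cubic_eval F u]/(trilinear _ _ _) -[cubic_eval F v]/(trilinear _ _ _).
by rewrite !(tri1, tri2, tri3); ring.
Qed.

Lemma cubic_eval3 u v w x y z : cubic_eval F (x *: u + y *: v + z *: w) =
  x ^+ 3 * cubic_eval F u + y ^+ 3 * cubic_eval F v + z ^+ 3 * cubic_eval F w +
  x ^+ 2 * y * dF u v + x * y ^+ 2 * dF v u + x ^+ 2 * z * dF u w +
  x * z ^+ 2 * dF w u + y ^+ 2 * z * dF v w + y * z ^+ 2 * dF w v +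
  x * y * z * polar u v w.
Proof.
have -> : x *: u + y *: v + z *: w = 1 *: (x *: u + y *: v) + z *: w by rewrite scale1r.
by rewrite cubic_eval2 cubic_eval2 dF_quad dF_lin; ring.
Qed.

Lemma cubic_evalZ u x : cubic_eval F (x *: u) = x ^+ 3 * cubic_eval F u.
Proof. by have := cubic_eval2 u 0 x 0; rewrite scale0r addr0 => ->; ring. Qed.

Lemma dF_delta u l : dF u (delta_mx 0 l) = cubic_partial F l u.
Proof.
rewrite /dF /trilinear /cubic_partial -!big_split; apply: eq_bigr => i _.
rewrite -!big_split; apply: eq_bigr => j _; rewrite -!big_split.
by apply: eq_bigr => k _ /=; rewrite !mxE eqxx /=; ring.
Qed.

End Polarization.

Section Map.
Variables (K L : fieldType) (f : {rmorphism K -> L}) (F : cubic K).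

Lemma dF_map u v : dF (cubic_map f F) (map_mx f u) (map_mx f v) = f (dF F u v).
Proof.
rewrite /dF !rmorphD /trilinear; congr (_ + _ + _);
  do 3![rewrite rmorph_sum; apply: eq_bigr => ? _];
  by rewrite !mxE !rmorphM.
Qed.

Lemma polar_map u v w : polar (cubic_map f F) (map_mx f u) (map_mx f v) (map_mx f w) =
  f (polar F u v w).
Proof.
rewrite /polar !rmorphD /trilinear; do 5?congr (_ + _);
  do 3![rewrite rmorph_sum; apply: eq_bigr => ? _];
  by rewrite !mxE !rmorphM.
Qed.

Lemma cubic_eval_map u : cubic_eval (cubic_map f F) (map_mx f u) = f (cubic_eval F u).
Proof.
rewrite /cubic_eval; do 3![rewrite rmorph_sum; apply: eq_bigr => ? _].
by rewrite !mxE !rmorphM.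
Qed.

End Map.

Ltac vring := let i := fresh "i" in apply/rowP => i; rewrite !mxE; ring.
Ltac vfield := let i := fresh "i" in apply/rowP => i; rewrite !mxE; field.

(** * Lines and tangent planes *)

Section Lines.
Variable K : fieldType.
Implicit Types (u v w p e : 'rV[K]_4) (x y : K).

Definition free2 u v := forall s t, s *: u + t *: v = 0 -> s = 0 /\ t = 0.

Definition pair_mx u v : 'M[K]_(2, 4) := \matrix_(i < 2) (if i == 0 then u else v).

Lemma mul_pair_mx (w : 'rV_2) u v : w *m pair_mx u v = w 0 0 *: u + w 0 1 *: v.
Proof.
rewrite mulmx_sum_row !big_ord_recl big_ord0 addr0 !rowK /=.
by congr (_ + w 0 _ *: _); apply: val_inj.
Qed.

Definition row2 (x y : K) : 'rV[K]_2 := \row_i (if i == 0 then x else y).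

Lemma mul_row2 x y u v : row2 x y *m pair_mx u v = x *: u + y *: v.
Proof. by rewrite mul_pair_mx !mxE. Qed.

Lemma lin2_row2 x y (w : 'rV_2) : lin2 (row2 x y) w = y * w 0 0 - x * w 0 1.
Proof. by rewrite /lin2 !mxE. Qed.

Lemma rank_pair_mx u v : free2 u v -> \rank (pair_mx u v) = 2%N.
Proof.
move=> uv; apply/eqP/inj_row_free => w; rewrite mul_pair_mx => /uv[w0 w1].
by apply/rowP; case=> [[|[|//]] lti]; rewrite mxE; [rewrite -w0 | rewrite -w1]; congr (w 0 _);
  apply: val_inj.
Qed.

Lemma sub_pair_mx u v w : reflect (exists s t, w = s *: u + t *: v) (w <= pair_mx u v)%MS.
Proof.
apply: (iffP submxP) => [[x ->]|[s [t ->]]].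
  by exists (x 0 0), (x 0 1); rewrite mul_pair_mx.
by exists (row2 s t); rewrite mul_row2.
Qed.

Lemma pair_mx_row (M : 'M[K]_(2, 4)) : M = pair_mx (row 0 M) (row 1 M).
Proof.
apply/row_matrixP => i; rewrite rowK; case: eqP => [->//|i0].
by congr (row _ M); apply: val_inj; case: i i0 => [[|[|]]] //= ? i0; case: i0; apply: val_inj.
Qed.

Lemma rank2_basis (A : 'M[K]_(2, 4)) : \rank A = 2%N -> exists u v, A = pair_mx u v /\ free2 u v.
Proof.
move=> rA; exists (row 0 A), (row 1 A); split; first exact: pair_mx_row.
move=> s t E; have : row2 s t *m A = 0 *m A by rewrite {1}(pair_mx_row A) mul_row2 E mul0mx.
move/(row_free_inj (introT eqP rA)) => E'.
by split; [have := congr1 (fun w : 'rV_2 => w 0 0) E' | have := congr1 (fun w : 'rV_2 => w 0 1) E']; rewrite !mxE.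
Qed.

Lemma line_basis (A : 'M[K]_(2, 4)) p : \rank A = 2%N -> (p <= A)%MS -> p != 0 ->
  exists e, [/\ (e <= A)%MS, free2 p e &
    forall u, (u <= A)%MS -> exists x y, u = x *: p + y *: e].
Proof.
move=> /rank2_basis[u [v [-> uv]]] /sub_pair_mx[s [t ->]] p0.
have [s0|s0] := eqVneq s 0.
  have t0 : t != 0 by apply: contra_neq p0 => ->; rewrite s0 !scale0r addr0.
  exists u; split; first by apply/sub_pair_mx; exists 1, 0; rewrite scale1r scale0r addr0.
    move=> x y E; have [] := uv y (x * t); first by rewrite -E s0; vring.
    by move=> -> /eqP; rewrite mulf_eq0 (negPf t0) orbF => /eqP.
  by move=> w /sub_pair_mx[a [b ->]]; exists (b / t), a; rewrite s0; vfield.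
exists v; split; first by apply/sub_pair_mx; exists 0, 1; rewrite scale1r scale0r add0r.
  move=> x y E; have [] := uv (x * s) (x * t + y); first by rewrite -E; vring.
  by move=> /eqP; rewrite mulf_eq0 (negPf s0) orbF => /eqP ->; rewrite mul0r add0r.
by move=> w /sub_pair_mx[a [b ->]]; exists (a / s), (b - a / s * t); vfield.
Qed.

Variable F : cubic K.

Record line p e : Prop := Line {
  line_l : cubic_eval F p = 0; line_r : cubic_eval F e = 0;
  line_lr : dF F p e = 0; line_rl : dF F e p = 0 }.

Lemma line_id p : cubic_eval F p = 0 -> line p p.
Proof. by move=> Fp; split; rewrite // dF_id Fp mul0rn. Qed.

Lemma lineC p e : line p e -> line e p.
Proof. by case. Qed.

Lemma line_eval p e x y : line p e -> cubic_eval F (x *: p + y *: e) = 0.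
Proof. by case=> A B C D; rewrite cubic_eval2 A B C D; ring. Qed.

End Lines.

(** * Normal forms of tangent plane sections *)

Section Cubic.
Variables (K : fieldType) (F : cubic K).
Hypothesis K_large : exists s : seq K, uniq s /\ (4 <= size s)%N.
Hypothesis smoothF : smooth_cubic F.
Implicit Types (A B : 'M[K]_(2, 4)) (u v w p q e f g h : 'rV[K]_4) (a b c s t x y z : K).

(** [X^3 - k X] has at most three roots, so one of four elements avoids 0 and the square roots of
    [k]. The size of [K] enters only here. *)
Lemma exists_nonroot k : exists2 x : K, x != 0 & x ^+ 2 != k.
Proof.
have [s [us s4]] := K_large.
pose q : {poly K} := 'X^3 - k *: 'X.
have sq : size q = 4.
  by rewrite size_polyDl ?size_polyXn // size_polyN (leq_ltn_trans (size_scale_leq _ _)) // size_polyX.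
have q0 : q != 0 by rewrite -size_poly_eq0 sq.
have /allPn[x _ nrx] : ~~ all (root q) s.
  by apply/negP => /(max_poly_roots q0)/(_ us); rewrite sq ltnNge s4.
move: nrx; rewrite rootE !hornerE.
have -> : x ^+ 3 - k * x = x * (x ^+ 2 - k) by ring.
by rewrite mulf_eq0 negb_or subr_eq0 => /andP[]; exists x.
Qed.

(** Smoothness is a condition over closed fields, so a point with zero differential is carried to a
    closed extension of [K]. *)
Lemma nonsingular u : u != 0 -> cubic_eval F u = 0 -> exists v, dF F u v != 0.
Proof.
move=> u0 Fu; apply: contrapT => sing.
have [L [f]] := algebraically_closed_extension K.
have: map_mx f u = 0.
  apply: (smoothF (f := f)); first by rewrite cubic_eval_map Fu rmorph0.
  move=> l; rewrite -dF_delta -(map_delta_mx f) dF_map.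
  have [->|] := eqVneq (dF F u (delta_mx 0 l)) 0; first by rewrite rmorph0.
  by move=> ne; case: sing; exists (delta_mx 0 l).
by move/eqP; rewrite map_mx_eq0 (negPf u0).
Qed.

Local Notation line := (line F).

(** The restricted form has only its two mixed coefficients left; the values at [(1,1)] and at
    [(1,x)] with [x] different from 0 and 1 kill both. *)
Lemma line_of_eval p e : (forall x y, cubic_eval F (x *: p + y *: e) = 0) -> line p e.
Proof.
move=> H.
have Fp : cubic_eval F p = 0 by have := H 1 0; rewrite scale1r scale0r addr0.
have Fe : cubic_eval F e = 0 by have := H 0 1; rewrite scale1r scale0r add0r.
have [x x0 x1] := exists_nonroot 1.
have := H 1 1; rewrite cubic_eval2 Fp Fe => E1.
have := H 1 x; rewrite cubic_eval2 Fp Fe => E2.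
have E : dF F p e = - dF F e p by apply/eqP; rewrite -addr_eq0 -E1; apply/eqP; ring.
have /eqP : dF F e p * (x * (x - 1)) = 0 by rewrite -[RHS]E2 E; ring.
rewrite !mulf_eq0 (negPf x0) /= subr_eq0; case: eqP => [De _|_ /eqP xe].
  by split; rewrite // E De oppr0.
by move: x1; rewrite xe expr1n eqxx.
Qed.

Lemma line_lin p e x y z t : line p e -> line (x *: p + y *: e) (z *: p + t *: e).
Proof.
move=> l; apply: line_of_eval => a b.
rewrite (_ : _ + _ = (a * x + b * z) *: p + (a * y + b * t) *: e); last by vring.
exact: line_eval.
Qed.

(* Every line in S and its tangent plane at a point where the Gauss map of the
   line is unramified can be put in this form: e is the second point at which the
   residual conic xy + c z^2 meets the line, and c = 0 is the case of a triangle. *)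
Record frame p e f c : Prop := Frame {
  frame_line : line p e;
  frame_pf : dF F p f = 0; frame_ef : dF F e f = 0;
  frame_fp : dF F f p = 0; frame_fe : dF F f e = 0;
  frame_polar : polar F p e f = 1; frame_f : cubic_eval F f = c }.

Lemma frame_eval p e f c x y z v : frame p e f c -> v = x *: p + y *: e + z *: f ->
  cubic_eval F v = z * (x * y + c * z ^+ 2).
Proof.
case=> -[A1 A2 A3 A4] B C D E G H ->.
by rewrite cubic_eval3 A1 A2 A3 A4 B C D E G H; ring.
Qed.

Lemma frame_swap p e f c : frame p e f c -> frame e p f c.
Proof. by case=> l *; split; rewrite // 1?polarC //; apply: lineC. Qed.

(** For [c = 0] the section is [xyz = 0], which is symmetric in the three vertices. *)
Lemma frame_rot p e f : frame p e f 0 -> frame e f p 0.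
Proof. by case=> -[A1 A2 A3 A4] *; split; rewrite // -polar_rot. Qed.

(** Polarizing a relation against two of the three vectors isolates the coefficient of the third, in
    any characteristic. *)
Lemma frame_free p e f c x y z : frame p e f c ->
  x *: p + y *: e + z *: f = 0 -> [/\ x = 0, y = 0 & z = 0].
Proof.
case=> -[A1 A2 A3 A4] Dpf Def Dfp Dfe Epol _ E.
have H u v : x * polar F u v p + y * polar F u v e + z * polar F u v f = 0.
  by rewrite -polar_lin3 E polar0.
have z0 : z = 0 by rewrite -[RHS](H p e) polar_l polar_r A3 A4 Epol; ring.
have y0 : y = 0.
  by rewrite -[RHS](H p f) z0 polar_l Dpf polarCA Epol; ring.
have x0 : x = 0.
  by rewrite -[RHS](H e f) z0 y0 -polar_rot Epol; ring.
by [].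
Qed.

(** Completing the product: the residual conic [a xy + dF f p xz + dF f e yz + F(f) z^2] loses its
    [xz] and [yz] terms after a shift of [f] along the line. *)
Lemma mk_frame p e f a : line p e -> dF F p f = 0 -> dF F e f = 0 ->
  a != 0 -> polar F p e f = a ->
  frame p (a^-1 *: e) ((- (dF F f e / a)) *: p + (- (dF F f p / a)) *: e + 1 *: f)
    (cubic_eval F f - dF F f p * dF F f e / a).
Proof.
case=> A1 A2 A3 A4 Dpf Def a0 Ea.
have pee : polar F p e e = 0 by rewrite polar_r A4 mul0rn.
have pep : polar F p e p = 0 by rewrite polar_l A3 mul0rn.
have pfp : polar F p f p = 0 by rewrite polar_l Dpf mul0rn.
have efe : polar F e f e = 0 by rewrite polar_l Def mul0rn.
have pfe : polar F p f e = a by rewrite polarCA.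
have efp : polar F e f p = a by rewrite -polar_rot.
have pp : dF F p p = 0 by rewrite dF_id A1 mul0rn.
have ee : dF F e e = 0 by rewrite dF_id A2 mul0rn.
split; [split | .. ].
- by [].
- by rewrite cubic_evalZ A2 mulr0.
- by rewrite dFZr A3 mulr0.
- by rewrite dFZl A4 mulr0.
- by rewrite dF_lin3 pp A3 Dpf; ring.
- by rewrite dFZl dF_lin3 A4 ee Def; ring.
- by rewrite dF_quad3 pep pp A4 pfp efp; field.
- by rewrite dFZr dF_quad3 A3 ee pee pfe efe; field.
- by rewrite polarZ polar_lin3 pep pee Ea; field.
by rewrite cubic_eval3 A1 A2 A3 A4 Dpf Def Ea; field.
Qed.

(** On the line, the derivative towards [f] factors as a multiple of the coordinate vanishing at [p]
    and a second linear form; the zero [e1] of that form is the other point with [f] in its tangent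
    plane. The last clause treats the case where the line [p f] lies in S and the conic splits. *)
Lemma tangent_frame p e f : line p e -> dF F p f = 0 -> polar F p e f != 0 ->
  exists a b x y c, [/\ b != 0, frame p (a *: p + b *: e) (x *: p + y *: e + 1 *: f) c &
    dF F f p = 0 -> cubic_eval F f = 0 -> y = 0 /\ c = 0].
Proof.
move=> l Dpf; set al := polar F p e f => al0; have [A1 A2 A3 A4] := l.
pose a := dF F e f; pose e1 := a *: p + (- al) *: e.
have De1 : dF F e1 f = 0 by rewrite dF_quad Dpf -/al -/a; ring.
have pol1 : polar F p e1 f = - al ^+ 2.
  rewrite polarCA polar_lin polar_l Dpf polarCA -/al; ring.
have n0 : - al ^+ 2 != 0 by rewrite oppr_eq0 expf_neq0.
have l1 : line p e1 by have := line_lin 1 0 a (- al) l; rewrite scale1r scale0r addr0.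
have := mk_frame l1 Dpf De1 n0 pol1.
set m := - al ^+ 2 in n0 *; set i := - (dF F f e1 / m); set j := - (dF F f p / m) => fr.
exists (m^-1 * a), (m^-1 * - al), (i + j * a), (j * - al),
  (cubic_eval F f - dF F f p * dF F f e1 / m).
split; first by apply: mulf_neq0; [rewrite invr_eq0 | rewrite oppr_eq0].
  rewrite (_ : _ *: p + (m^-1 * - al) *: e = m^-1 *: e1); last by rewrite /e1; vring.
  rewrite (_ : _ + 1 *: f = i *: p + j *: e1 + 1 *: f) //; rewrite /e1; vring.
by move=> Dfp Ff; rewrite /j Dfp Ff !mul0r oppr0 !mul0r addr0.
Qed.

Lemma frame_span p e f c h v : frame p e f c -> dF F p h != 0 ->
  exists x y z t, v = x *: p + y *: e + z *: f + t *: h.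
Proof.
move=> fr Dph.
pose N : 'M[K]_4 := \matrix_(i < 4) nth 0 [:: p; e; f; h] i.
have mulN (w : 'rV_4) : exists x y z t, w *m N = x *: p + y *: e + z *: f + t *: h /\
    (x = 0 -> y = 0 -> z = 0 -> t = 0 -> w = 0).
  exists (w 0 0), (w 0 1), (w 0 2), (w 0 3); split.
    rewrite mulmx_sum_row !big_ord_recl big_ord0 addr0 !rowK /= !addrA.
    by congr (_ + w 0 _ *: _ + w 0 _ *: _ + w 0 _ *: _); apply: val_inj.
  move=> E0 E1 E2 E3; apply/rowP; case=> [[|[|[|[|//]]]] lti]; rewrite mxE;
    [rewrite -E0 | rewrite -E1 | rewrite -E2 | rewrite -E3]; congr (w 0 _); exact: val_inj.
suff uN : N \in unitmx.
  have [x [y [z [t [E _]]]]] := mulN (v *m invmx N).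
  by exists x, y, z, t; rewrite -E mulmxKV.
rewrite -row_free_unit; apply: inj_row_free => w.
have [x [y [z [t [-> w0]]]]] := mulN w => E.
have [[A1 A2 A3 A4] Dpf _ _ _ _ _] := fr.
have t0 : t = 0.
  apply/eqP; move/eqP: (congr1 (dF F p) E).
  rewrite -[x *: p + _ + _]scale1r dF_lin dF_lin3 dF0 dF_id A1 A3 Dpf.
  by rewrite mul0rn !mulr0 !addr0 mulr0 add0r mulf_eq0 (negPf Dph) orbF.
by move: E; rewrite t0 scale0r addr0 => /(frame_free fr)[x0 y0 z0]; apply: w0.
Qed.

Lemma frame_neq0 p e f c : frame p e f c -> p != 0.
Proof.
case=> _ _ _ _ _ + _; apply: contra_eq_neq => ->.
by rewrite -(scale0r e) polarC -[0 *: e]scale1r polarZ scale0r polarC polar_rot polar0 mulr0 eq_sym oner_eq0.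
Qed.

(* The Gauss map of the line sends p + y e to a f-coordinate y against an
   h-coordinate a + y^2 b; it ramifies only where y^2 = a / b. *)
Lemma frame_other p e f c : frame p e f c ->
  exists y z t g c', [/\ y != 0, z != 0, t != 0, t - y * z != 0 &
    frame (1 *: p + y *: e) (z *: p + t *: e) g c'].
Proof.
move=> fr; have [l Dpf Def _ _ Epol _] := fr; have [A1 A2 A3 A4] := l.
have [h0 Dh0] := nonsingular (frame_neq0 fr) A1.
(* Subtracting a multiple of [f] makes the mixed term of the [h]-coordinate of the Gauss map
   vanish. *)
pose h := 1 *: h0 + (- polar F p e h0) *: f.
have pol_h : polar F p e h = 0 by rewrite polar_lin Epol; ring.
have a0 : dF F p h != 0 by rewrite dF_lin Dpf mulr0 addr0 mul1r.
have b0 : dF F e h != 0.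
  have [v] := nonsingular (frame_neq0 (frame_swap fr)) A2.
  have [x [y [z [t ->]]]] := frame_span v fr a0; apply: contra_neq => b0.
  rewrite -[x *: p + _ + _]scale1r dF_lin dF_lin3 A4 Def b0 dF_id A2; ring.
have [a Ea] : exists a, dF F p h = a by eexists.
have [b Eb] : exists b, dF F e h = b by eexists.
rewrite Ea in a0; rewrite Eb in b0.
have [y y0 ny] := exists_nonroot (a / b).
have d0 : a - y ^+ 2 * b != 0.
  by apply: contraNneq ny => /eqP; rewrite subr_eq0 => /eqP ->; rewrite mulfK.
pose d := (a - y ^+ 2 * b) ^+ 2.
have dn0 : d != 0 by rewrite expf_neq0.
have nn : d^-1 != 0 by rewrite invr_eq0.
exists y, (d^-1 * (y * b)), (d^-1 * a); do 2 eexists; split.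
- by [].
- by rewrite !mulf_neq0.
- by rewrite !mulf_neq0.
- by rewrite (_ : _ - _ = d^-1 * (a - y ^+ 2 * b)) ?mulf_neq0 //; ring.
(* At [y b p + a e] the derivatives towards [f] and [h] are [a b] times those at [p + y e], so both
   points have the same tangent plane; [d] is the polar value that [mk_frame] divides by. *)
have -> : (d^-1 * (y * b)) *: p + (d^-1 * a) *: e = d^-1 *: ((y * b) *: p + a *: e) by vring.
apply: (@mk_frame _ _ ((a + y ^+ 2 * b) *: f + (- y) *: h)) => //.
- exact: line_lin.
- by rewrite dF_lin !dF_quad Dpf Def Epol pol_h Ea Eb; ring.
- by rewrite dF_lin !dF_quad Dpf Def Epol pol_h Ea Eb; ring.
by rewrite polar_lin !polar_quad Dpf Def Epol pol_h Ea Eb /d; ring.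
Qed.

(** * Skew lines and ramification of the Gauss map *)

Record skew A A' : Prop := Skew {
  skew_l : line_on F A; skew_r : line_on F A';
  skew_cap : \rank (A :&: A')%MS = 0%N }.

Lemma skewC A A' : skew A A' -> skew A' A.
Proof. by case=> *; split; rewrite // capmxC. Qed.

Lemma line_onP A u v : line_on F A -> (u <= A)%MS -> (v <= A)%MS -> line u v.
Proof.
case=> _ FA uA vA; apply: line_of_eval => x y.
have /submxP[w ->] : ((x *: u + y *: v)%R <= A)%MS by rewrite addmx_sub ?scalemx_sub.
exact: FA.
Qed.

Lemma skew_disj A A' u : skew A A' -> (u <= A)%MS -> (u <= A')%MS -> u = 0.
Proof.
case=> _ _ /eqP; rewrite mxrank_eq0 => /eqP E uA uA'.
by apply/eqP; rewrite -submx0 -E sub_capmx uA.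
Qed.

Lemma skew_sum A A' v : skew A A' -> exists u w, [/\ (u <= A)%MS, (w <= A')%MS & v = u + w].
Proof.
case=> [[rA _] [rA' _] rAA'].
have: (v <= A + A')%MS.
  by apply: submx_full; rewrite /row_full -(eqn_add2r (\rank (A :&: A')%MS)) mxrank_sum_cap rA rA' rAA'.
case/sub_addsmxP => -[a b] /= ->.
by exists (a *m A), (b *m A'); rewrite !submxMl.
Qed.

Lemma skew_nonsingular A A' u : skew A A' -> u != 0 -> cubic_eval F u = 0 ->
  (forall v, (v <= A)%MS -> dF F u v = 0) -> (forall v, (v <= A')%MS -> dF F u v = 0) -> False.
Proof.
move=> sk u0 Fu DA DA'; have [v] := nonsingular u0 Fu.
have [a [b [aA bA ->]]] := skew_sum v sk.
by have := dF_lin F u a b 1 1; rewrite !scale1r (DA a aA) (DA' b bA) mulr0 addr0 => ->; rewrite eqxx.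
Qed.

Lemma tangent_on A p : \rank A = 2%N -> exists y : 'rV[K]_4, [/\ (y <= A)%MS, y != 0 & dF F p y = 0].
Proof.
move=> /rank2_basis[u [v [-> uv]]].
have nz s t : (s != 0) || (t != 0) -> s *: u + t *: v != 0.
  by apply: contraTneq => /uv[-> ->]; rewrite eqxx.
have [Dv|Dv] := eqVneq (dF F p v) 0.
  exists (0 *: u + 1 *: v); split; last by rewrite dF_lin Dv; ring.
    by apply/sub_pair_mx; eexists; eexists.
  by rewrite nz // oner_neq0 orbT.
exists (dF F p v *: u + (- dF F p u) *: v); split; last by rewrite dF_lin; ring.
  by apply/sub_pair_mx; eexists; eexists.
by rewrite nz // Dv.
Qed.

(* Otherwise the tangent planes at the points of A would, over the algebraic closure,
   degenerate at a root of a binary quadratic form. *)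
Lemma gauss_nonconstant A A' p e (y : 'rV[K]_4) : skew A A' ->
  (p <= A)%MS -> (e <= A)%MS -> free2 p e -> (forall u, (u <= A)%MS -> exists x y, u = x *: p + y *: e) ->
  (y <= A')%MS -> y != 0 -> dF F p y = 0 -> polar F p e y = 0 -> dF F e y != 0.
Proof.
move=> sk pA eA pe spanA yA' y0 Dpy pol; apply/negP => /eqP Dey.
have [h [hA' _ spanA']] := line_basis (skew_r sk).1 yA' y0.
have [A1 A2 A3 A4] := line_onP (skew_l sk) pA eA.
have [L [f]] := algebraically_closed_extension K.
pose al := f (dF F p h); pose be := f (polar F p e h); pose ga := f (dF F e h).
have [X [Y [XY root]]] : exists X Y : L, (X != 0) || (Y != 0) /\
    X ^+ 2 * al + X * Y * be + Y ^+ 2 * ga = 0.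
  have [ga0|ga0] := eqVneq ga 0.
    by exists 0, 1; rewrite oner_neq0 orbT ga0; split=> //; ring.
  have [Y EY] := @solve_monicpoly L 2 (nth 0 [:: - al / ga; - be / ga]) isT.
  exists 1, Y; rewrite oner_neq0; split=> //.
  move: EY; rewrite !big_ord_recl big_ord0 /= expr0 mulr1 addr0 => ->.
  by rewrite /bump /= expr1; field.
pose u := X *: map_mx f p + Y *: map_mx f e.
have u0 : u != 0.
  apply: contraTneq XY => E.
  have rk : \rank (map_mx f (pair_mx p e)) = 2%N by rewrite mxrank_map rank_pair_mx.
  have : row2 X Y *m map_mx f (pair_mx p e) = 0 *m map_mx f (pair_mx p e).
    rewrite mul0mx -[RHS]E (pair_mx_row (map_mx f _)) mul_row2 -!map_row.
    by rewrite !rowK.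
  move/(row_free_inj (introT eqP rk)) => E'.
  have X0 : X = 0 by have := congr1 (fun w : 'rV_2 => w 0 0) E'; rewrite !mxE.
  have Y0 : Y = 0 by have := congr1 (fun w : 'rV_2 => w 0 1) E'; rewrite !mxE.
  by rewrite X0 Y0 eqxx.
(* [u] is singular: derivatives along A vanish as A lies in S, those towards [y] by hypothesis, and
   those towards [h] by the choice of the root. *)
case/eqP: u0; apply: (smoothF (f := f)).
  by rewrite cubic_eval2 !cubic_eval_map !dF_map A1 A2 A3 A4 !rmorph0; ring.
move=> l; rewrite -dF_delta -(map_delta_mx f).
have [a [b [/spanA[x1 [x2 ->]] /spanA'[x3 [x4 ->]] ->]]] := skew_sum (delta_mx 0 l) sk.
rewrite dF_quad !dF_map polar_map.
have -> : x1 *: p + x2 *: e + (x3 *: y + x4 *: h) =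
  1 *: (x1 *: p + x2 *: e) + 1 *: (x3 *: y + x4 *: h) by rewrite !scale1r.
rewrite !dF_lin !polar_lin !dF_id A1 A2 A3 A4 Dpy Dey pol polar_l polar_r A3 A4.
have E z : f (1 * (x1 * 0 + x2 * 0) + 1 * (x3 * 0 + x4 * z)) = f x4 * f z.
  by rewrite -rmorphM; congr (f _); ring.
rewrite !mul0rn !E -/al -/be -/ga.
by rewrite -[RHS](mulr0 (f x4)) -root; ring.
Qed.

Lemma line_on_map (L : fieldType) (f : {rmorphism K -> L}) u v : line u v -> free2 u v ->
  line_on (cubic_map f F) (map_mx f (pair_mx u v)).
Proof.
case=> A1 A2 A3 A4 uv; split; first by rewrite mxrank_map rank_pair_mx.
move=> w; rewrite (pair_mx_row (map_mx f _)) mul_pair_mx -!map_row !rowK line_eval //.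
by split; rewrite ?cubic_eval_map ?dF_map (A1, A2, A3, A4) rmorph0.
Qed.

(** With coordinates [(x,y,z)] on [p, e, q] the tangent section is [yz (a y + b z)], three distinct
    lines through [p]; [r] lies on the third. *)
Lemma eckardt_ramified A A' p e q : skew A A' ->
  (p <= A)%MS -> (e <= A)%MS -> free2 p e ->
  (forall u, (u <= A)%MS -> exists x y, u = x *: p + y *: e) ->
  (q <= A')%MS -> q != 0 -> dF F p q = 0 -> polar F p e q = 0 -> dF F q p = 0 ->
  eckardt F p.
Proof.
move=> sk pA eA pe span qA' q0 Dpq pol Dqp.
have l := line_onP (skew_l sk) pA eA; have [Fp Fe Dpe Dep] := l.
have [Fq _ _ _] := line_onP (skew_r sk) qA' qA'.
have a0 := gauss_nonconstant sk pA eA pe span qA' q0 Dpq pol.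
have b0 : dF F q e != 0.
  apply/negP => /eqP Dqe; apply: (skew_nonsingular sk q0 Fq).
    by move=> ? /span[x [y ->]]; rewrite dF_lin Dqp Dqe; ring.
  by move=> z zA'; have [] := line_onP (skew_r sk) qA' zA'.
have [a Ea] : exists a, dF F e q = a by eexists.
have [b Eb] : exists b, dF F q e = b by eexists.
rewrite Ea in a0; rewrite Eb in b0.
have free3 x y z : x *: p + y *: e + z *: q = 0 -> [/\ x = 0, y = 0 & z = 0].
  move=> E; have Z : x *: p + y *: e = 0.
    apply: (skew_disj sk); first by rewrite addmx_sub ?scalemx_sub.
    by move/eqP: E; rewrite addr_eq0 => /eqP ->; rewrite -scaleNr scalemx_sub.
  have [x0 y0] := pe _ _ Z; split=> //.
  by move/eqP: E; rewrite Z add0r scaler_eq0 (negPf q0) orbF => /eqP.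
pose r := b *: e + (- a) *: q.
have lpq : line p q by split.
have lpr : line p r.
  split=> //; rewrite /r.
  - by rewrite cubic_eval2 Fe Fq Ea Eb; ring.
  - by rewrite dF_lin Dpe Dpq; ring.
  by rewrite dF_quad Dep Dqp -polar_rot pol; ring.
have fpq : free2 p q.
  by move=> s t E; have [|-> _ ->] := free3 s 0 t; rewrite // scale0r addr0.
have fpr : free2 p r.
  move=> s t E; have [|-> /eqP] := free3 s (t * b) (- (t * a)).
    by rewrite -[RHS]E /r; vring.
  by rewrite mulf_eq0 (negPf b0) orbF => /eqP ->.
have [L [f]] := algebraically_closed_extension K.
split=> //; exists L, f, (map_mx f (pair_mx p e)), (map_mx f (pair_mx p q)), (map_mx f (pair_mx p r)).
have sub u w : (map_mx f u <= map_mx f (pair_mx u w))%MS.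
  by rewrite map_submx; apply/sub_pair_mx; exists 1, 0; rewrite scale1r scale0r addr0.
have sub2 u w : (w <= pair_mx u w)%MS.
  by apply/sub_pair_mx; exists 0, 1; rewrite scale1r scale0r add0r.
have neq M N w : (w <= M)%MS -> ~~ (w <= N)%MS -> ~~ (map_mx f M == map_mx f N)%MS.
  by move=> wM; apply: contra => /andP[]; rewrite map_submx => MN _; apply: submx_trans MN.
split; try exact: line_on_map; first by split; apply: sub.
split; rewrite andbC; apply: neq (sub2 _ _) _; apply/sub_pair_mx => -[s [t E]].
- by have [|_ _ /eqP] := free3 s t (- 1); [rewrite E; vring | rewrite oppr_eq0 oner_eq0].
- have [|_ _ /eqP] := free3 (- s) (b - t) (- a); last by rewrite oppr_eq0 (negPf a0).
  by rewrite -(subrr r) {2}E /r; vring.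
have [|_ /eqP] := free3 (- s) b (- a - t); last by rewrite (negPf b0).
by rewrite -(subrr r) {2}E /r; vring.
Qed.

(** * The secant and tangent process *)

Section Generation.
Variable P0 : 'rV[K]_4.
Hypothesis P0_neq0 : P0 != 0.
Local Notation G := (SpanPt F P0).

Lemma SpanPt_neq0 v : G v -> v != 0.
Proof. by elim=> [x [a a0 ->]|P Q R _ _ _ _ [[]]//]; rewrite scaler_eq0 negb_or a0. Qed.

Lemma SpanPt_scale v x : x != 0 -> G v -> G (x *: v).
Proof.
move=> x0; case=> [w [a a0 ->]|P Q R GP GQ [[P0' Q0 R0] [M [p [q [r [c [rM [EP EQ ER] c0 H]]]]]]]].
  by apply: Span_base; exists (x * a); rewrite ?scalerA ?mulf_neq0.
apply: Span_step GP GQ _; split; first by rewrite scaler_eq0 negb_or x0.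
exists M, p, q, (x *: r), (c / x); split; rewrite ?mulf_neq0 ?invr_eq0 //.
  by rewrite ER -scalemxAl.
by move=> w; rewrite H /lin2 !mxE; field.
Qed.

Lemma SpanPt_scaleE v x : x != 0 -> G (x *: v) -> G v.
Proof.
move=> x0 /(SpanPt_scale (invr_neq0 x0)); rewrite scalerA mulVf // scale1r //.
Qed.

(** A nonzero restricted form certifies that [u] and [v] span a line, because proportional vectors
    give only zeros. *)
Let free2_of_eval u v (q : K -> K -> K) :
  u != 0 -> cubic_eval F u = 0 ->
  (forall s t, cubic_eval F (s *: u + t *: v) = q s t) ->
  free2 u v \/ forall s t, q s t = 0.
Proof.
move=> u0 Fu H; have [[k vk]|nk] := pselect (exists k, v = k *: u).
  by right=> s t; rewrite -H vk scalerA -scalerDl -[_ *: u]addr0 -(scale0r u) line_eval //;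
    apply: line_id.
left=> s t E; have [t0|t0] := eqVneq t 0.
  move: E; rewrite t0 scale0r addr0 => /eqP.
  by rewrite scaler_eq0 (negPf u0) orbF => /eqP.
case: nk; exists (- (s / t)); apply: (scalerI t0).
by rewrite scalerA mulrN mulrCA divff // mulr1 scaleNr; apply/eqP; rewrite -addr_eq0 addrC E.
Qed.

(** The residual linear factor [x s + y t] vanishes at [(y, -x)]. *)
Lemma third_point u v x y : G u -> G v ->
  (forall s t, cubic_eval F (s *: u + t *: v) = s * t * (x * s + y * t)) ->
  x != 0 \/ y != 0 -> G (y *: u - x *: v).
Proof.
move=> Gu Gv H xy.
have Fu : cubic_eval F u = 0.
  by have := H 1 0; rewrite scale1r scale0r addr0 mulr0 mul0r.
have [uv|Z] := free2_of_eval (SpanPt_neq0 Gu) Fu H; last first.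
  have [z z0 z1] := exists_nonroot 1.
  have := Z 1 1; rewrite !mulr1 mul1r => /eqP; rewrite addr_eq0 => /eqP Ex.
  have /eqP := Z 1 z; rewrite mul1r mulr1 Ex -mulrN1 -mulrDr !mulf_eq0 (negPf z0) /=.
  case: eqP => [Ey _|_ /eqP z1']; first by move: xy; rewrite Ex Ey oppr0 eqxx => -[].
  move: z1; rewrite (_ : z = 1) ?expr1n ?eqxx //.
  by apply/eqP; rewrite -subr_eq0 addrC z1'.
apply: (Span_step Gu Gv); split.
  split; [exact: SpanPt_neq0 Gu | exact: SpanPt_neq0 Gv |].
  apply/eqP; rewrite -scaleNr => /uv[y0 /eqP]; rewrite oppr_eq0 => x0.
  by move: xy; rewrite y0 x0 eqxx => -[].
exists (pair_mx u v), (row2 1 0), (row2 0 1), (row2 y (- x)), 1.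
split; rewrite ?oner_neq0 ?rank_pair_mx //.
  by rewrite !mul_row2; split; vring.
by move=> w; rewrite mul_pair_mx H !lin2_row2; ring.
Qed.

Lemma tangent_point u v x y : G u ->
  (forall s t, cubic_eval F (s *: u + t *: v) = t ^+ 2 * (x * s + y * t)) ->
  x != 0 \/ y != 0 -> G (y *: u - x *: v).
Proof.
move=> Gu H xy.
have Fu : cubic_eval F u = 0.
  by have := H 1 0; rewrite scale1r scale0r addr0 expr0n mul0r.
have [uv|Z] := free2_of_eval (SpanPt_neq0 Gu) Fu H; last first.
  have := Z 0 1; rewrite expr1n !mul1r mulr0 add0r mulr1 => y0.
  have := Z 1 1; rewrite expr1n !mul1r y0 mulr1 mul0r addr0 => x0.
  by move: xy; rewrite x0 y0 eqxx => -[].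
apply: (Span_step Gu Gu); split.
  split; [exact: SpanPt_neq0 Gu | exact: SpanPt_neq0 Gu |].
  apply/eqP; rewrite -scaleNr => /uv[y0 /eqP]; rewrite oppr_eq0 => x0.
  by move: xy; rewrite y0 x0 eqxx => -[].
(* [lin2] at [(1,0)] is [-t], which is squared, and at [(y,-x)] it is [-(x s + y t)]; hence the
   constant is -1. *)
exists (pair_mx u v), (row2 1 0), (row2 1 0), (row2 y (- x)), (- 1).
split; rewrite ?oppr_eq0 ?oner_neq0 ?rank_pair_mx //.
  by rewrite !mul_row2; split; vring.
by move=> w; rewrite mul_pair_mx H !lin2_row2; ring.
Qed.

(** * Generating all points of a line from one or two of its points *)

Definition filled p e := forall x y, x *: p + y *: e != 0 -> G (x *: p + y *: e).

Lemma filled_change p e a b c d : a * d - b * c != 0 ->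
  filled (a *: p + b *: e) (c *: p + d *: e) -> filled p e.
Proof.
move=> det0 fl x y.
have -> : x *: p + y *: e =
    ((x * d - y * c) / (a * d - b * c)) *: (a *: p + b *: e) +
    ((y * a - x * b) / (a * d - b * c)) *: (c *: p + d *: e) by vfield.
exact: fl.
Qed.

(** The line through [p] and [e + z f] is tangent to S at [p] and meets the conic [xy + c z^2 = 0]
    again at this point. *)
Lemma conic_points p e f c z : frame p e f c -> G p -> z != 0 ->
  G ((- c * z ^+ 2) *: p + 1 *: e + z *: f).
Proof.
move=> fr Gp z0; apply: (@SpanPt_scaleE _ (- z)); first by rewrite oppr_eq0.
rewrite (_ : _ *: _ = (c * z ^+ 3) *: p - z *: (e + z *: f)); last by vring.
apply: tangent_point Gp _ _; last by left.
move=> s t; rewrite (frame_eval (x := s) (y := t) (z := t * z) fr); last by vring.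
by ring.
Qed.

(** A chord joining a conic point found from [p] to one found from [e] meets the line at the
    prescribed [x p + y e]. *)
Lemma filled_conj p e f c : frame p e f c -> G p -> G e -> filled p e.
Proof.
move=> fr Gp Ge x y.
have [->|x0] := eqVneq x 0.
  by rewrite scale0r add0r scaler_eq0 negb_or => /andP[y0 _]; apply: SpanPt_scale.
have [-> _|y0 _] := eqVneq y 0.
  by rewrite scale0r addr0; apply: SpanPt_scale.
(* This choice keeps the two conic points distinct. If [c = 0] the inverse is 0 by convention and
   the condition only repeats that [l] is nonzero. *)
have [l l0 nl] := exists_nonroot (c * x * y)^-1.
have k0 : 1 - c * l ^+ 2 * x * y != 0.
  apply: contraNneq nl => /eqP; rewrite subr_eq0 => /eqP E.
  have E2 : l ^+ 2 * (c * x * y) = 1 by rewrite [RHS]E; ring.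
  have nz : c * x * y != 0.
    by apply/eqP => nz; move/eqP: E2; rewrite nz mulr0 eq_sym oner_eq0.
  by apply/eqP/(mulIf nz); rewrite mulVf.
have xl0 : - (l * x) != 0 by rewrite oppr_eq0 mulf_neq0.
have yl0 : l * y != 0 by rewrite mulf_neq0.
have GU := conic_points fr Gp xl0.
have GV := conic_points (frame_swap fr) Ge yl0.
move: k0; set k := 1 - _ => k0.
apply: (@SpanPt_scaleE _ (k ^+ 3 * l)); first by rewrite mulf_neq0 ?expf_neq0.
rewrite (_ : _ *: _ = (l * y * k ^+ 2) *: ((- c * (- (l * x)) ^+ 2) *: p + 1 *: e + (- (l * x)) *: f)
  - (- (l * x) * k ^+ 2) *: ((- c * (l * y) ^+ 2) *: e + 1 *: p + (l * y) *: f)); last first.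
  by rewrite /k; vring.
apply: third_point GU GV _ _; last by left; rewrite mulf_neq0 ?expf_neq0.
move=> s t; rewrite (frame_eval (x := s * (- c * (- (l * x)) ^+ 2) + t)
  (y := s + t * (- c * (l * y) ^+ 2)) (z := s * (- (l * x)) + t * (l * y)) fr).
  by rewrite /k; ring.
by vring.
Qed.

(** The line carries a second frame, in another tangent plane, whose base points avoid [p] and [e];
    they are generated, so [filled_conj] applies to them. *)
Lemma filled_almost p e f c : frame p e f c ->
  (forall x y, x != 0 -> y != 0 -> G (x *: p + y *: e)) -> filled p e.
Proof.
move=> fr almost.
have [y [z [t [g [c' [y0 z0 t0 det0 fr']]]]]] := frame_other fr.
apply: (@filled_change _ _ 1 y z t); first by rewrite mul1r.
by apply: (filled_conj fr'); apply: almost; rewrite ?oner_neq0.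
Qed.

Lemma filled_vertex p e f c : frame p e f c -> G p -> filled p e.
Proof.
move=> fr Gp; have [c0|c0] := eqVneq c 0.
  (* Tangents at [p] sweep out the opposite side except its vertices; filling that side yields the
     vertex [e]. *)
  rewrite c0 in fr; have fr' := frame_rot fr.
  apply: (filled_conj fr Gp); rewrite -[e]scale1r -[_ *: e]addr0 -(scale0r f).
  apply: (filled_almost fr'); last first.
    by rewrite scale1r scale0r addr0 (frame_neq0 fr').
  move=> x y x0 y0; have zy : y / x != 0 by rewrite mulf_neq0 ?invr_eq0.
  have /(SpanPt_scale x0) := conic_points fr Gp zy.
  by rewrite (_ : _ *: _ = x *: e + y *: f) //; vfield.
apply: (filled_almost fr) => x y x0 y0.
(* The chord between the conic points of parameters [z] and [w] meets the line at [c z w p + e]; so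
   [z w] is prescribed, and [z] is chosen to differ from [w]. *)
have [z z0 nz] := exists_nonroot (x / (y * c)).
pose w := x / (y * c) / z.
have w0 : w != 0 by rewrite !mulf_neq0 ?invr_eq0 ?mulf_neq0.
have zw : z - w != 0.
  by apply: contraNneq nz => /eqP; rewrite subr_eq0 => /eqP E; rewrite expr2 {2}E mulrC divfK.
have GU := conic_points fr Gp z0; have GV := conic_points fr Gp w0.
apply: (@SpanPt_scaleE _ (c * (z - w) ^+ 3 / y)).
  by rewrite !mulf_neq0 ?invr_eq0 ?expf_neq0.
rewrite (_ : _ *: _ = (- c * (z - w) ^+ 2 * w) *: ((- c * z ^+ 2) *: p + 1 *: e + z *: f)
  - (- c * (z - w) ^+ 2 * z) *: ((- c * w ^+ 2) *: p + 1 *: e + w *: f)); last first.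
  have -> : x = c * z * w * y by rewrite /w; field; rewrite z0 c0 y0.
  by vfield.
apply: third_point GU GV _ _; last by left; rewrite !mulf_neq0 ?expf_neq0 ?oppr_eq0.
move=> s t; rewrite (frame_eval (x := s * (- c * z ^+ 2) + t * (- c * w ^+ 2))
  (y := s + t) (z := s * z + t * w) fr); last by vring.
by ring.
Qed.

Lemma filled_triangle p e f : frame p e f 0 -> G p -> filled p f.
Proof.
move=> fr Gp; apply: (@filled_vertex _ _ e 0) Gp.
by apply: frame_swap; apply: frame_rot; apply: frame_rot.
Qed.

Lemma filled_unramified p e f : line p e -> dF F p f = 0 -> polar F p e f != 0 ->
  G p -> filled p e.
Proof.
move=> l Dpf al0 Gp; have [a [b [x [y [c [b0 fr _]]]]]] := tangent_frame l Dpf al0.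
have := filled_vertex fr Gp; rewrite -{1}[p]addr0 -(scale0r e) -{1}[p]scale1r.
by apply: filled_change; rewrite mul0r subr0 mul1r.
Qed.

(** Here the line [p f] lies in S, so the section is a triangle with [p f] as a side through [p]. *)
Lemma filled_transversal p e f : line p e -> dF F p f = 0 -> polar F p e f != 0 ->
  dF F f p = 0 -> cubic_eval F f = 0 -> G p -> filled p f.
Proof.
move=> l Dpf al0 Dfp Ff Gp; have [a [b [x [y [c [b0 fr]]]]]] := tangent_frame l Dpf al0.
move=> /(_ Dfp Ff)[y0 c0]; move: fr; rewrite y0 c0 scale0r addr0 => fr.
have := filled_triangle fr Gp; rewrite -{1}[p]addr0 -(scale0r f) -{1}[p]scale1r.
by apply: filled_change; rewrite mul0r subr0 mul1r oner_neq0.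
Qed.

(* At a ramification point of the Gauss map the residual conic a y^2 + b x z is
   tangent to the line. *)
Lemma filled_ramified p e f a b : line p e -> cubic_eval F f = 0 -> dF F p f = 0 ->
  polar F p e f = 0 -> dF F e f = a -> dF F f p = b -> a != 0 -> b != 0 ->
  G p -> filled p e.
Proof.
move=> l Ff Dpf pol Def Dfp a0 b0 Gp; have [A1 A2 A3 A4] := l.
(* Shifting [e] along the line removes the [yz] term of the conic. *)
pose k := - (dF F f e / b); pose e1 := k *: p + 1 *: e.
have ev x y z v : v = x *: p + y *: e1 + z *: f ->
    cubic_eval F v = z * (a * y ^+ 2 + b * x * z).
  move=> ->; rewrite (_ : _ + _ = (x + y * k) *: p + y *: e + z *: f); last by rewrite /e1; vring.
  by rewrite cubic_eval3 A1 A2 A3 A4 Ff Dpf pol Def Dfp /k; field.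
suff fl : filled p e1.
  apply: (@filled_change _ _ 1 0 k 1); first by rewrite mul1r mul0r subr0 oner_neq0.
  by rewrite scale1r scale0r addr0.
have Gf : G f.
  have := @tangent_point p f b 0 Gp; rewrite scale0r sub0r -scaleNr => H.
  apply: (@SpanPt_scaleE _ (- b)); first by rewrite oppr_eq0.
  apply: H; last by left.
  by move=> s t; rewrite (ev s 0 t); [ring | vring].
move=> x y; have [->|y0] := eqVneq y 0.
  rewrite scale0r addr0 scaler_eq0 negb_or => /andP[x0 _]; exact: SpanPt_scale.
move=> _; have [->|x0] := eqVneq x 0.
  have := @tangent_point f e1 a 0 Gf; rewrite scale0r sub0r scale0r add0r -scaleNr => H.
  apply: SpanPt_scale => //; apply: (@SpanPt_scaleE _ (- a)); first by rewrite oppr_eq0.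
  apply: H; last by left.
  by move=> s t; rewrite (ev 0 t s); [ring | vring].
(* [U] is the conic point whose chord to [f] meets the line in [x p + y e1]; it is found by a
   tangent at [p]. *)
pose m := - (x * b / (y * a)).
have m0 : m != 0 by rewrite oppr_eq0 !mulf_neq0 ?invr_eq0 ?mulf_neq0.
pose U := (- (a * m ^+ 2 / b)) *: p + m *: e1 + 1 *: f.
have GU : G U.
  apply: (@SpanPt_scaleE _ (- b)); first by rewrite oppr_eq0.
  rewrite (_ : _ *: _ = (a * m ^+ 2) *: p - b *: (m *: e1 + 1 *: f)); last by rewrite /U; vfield.
  apply: tangent_point Gp _ _; last by left.
  by move=> s t; rewrite (ev s (t * m) t); [ring | vring].
apply: (@SpanPt_scaleE _ (a * m ^+ 3 / y)); first by rewrite !mulf_neq0 ?invr_eq0 ?expf_neq0.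
rewrite (_ : _ *: _ = (- (a * m ^+ 2)) *: f - (- (a * m ^+ 2)) *: U); last first.
  have -> : x = - (m * y * a / b) by rewrite /m; field; rewrite a0 y0 b0.
  by rewrite /U; vfield; rewrite b0 y0.
apply: third_point Gf GU _ _; last by left; rewrite oppr_eq0 mulf_neq0 ?expf_neq0.
move=> s t; rewrite (ev (t * - (a * m ^+ 2 / b)) (t * m) (s + t)); last by rewrite /U; vring.
by field.
Qed.

(** * Spreading from a line to the whole surface *)

Definition covered A := forall u, (u <= A)%MS -> u != 0 -> G u.

Lemma filled_covered A p e : (forall u, (u <= A)%MS -> exists x y, u = x *: p + y *: e) ->
  filled p e -> covered A.
Proof. by move=> span fl u /span[x [y ->]]; apply: fl. Qed.

(** A and [q] span the tangent plane at [p], and [polar F p e q = 0] says that the Gauss map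
    ramifies at [p]; then [dF F q p != 0] keeps the conic smooth. *)
Lemma covered_line A A' p e q : skew A A' ->
  (p <= A)%MS -> (e <= A)%MS -> free2 p e ->
  (forall u, (u <= A)%MS -> exists x y, u = x *: p + y *: e) ->
  (q <= A')%MS -> q != 0 -> dF F p q = 0 ->
  polar F p e q != 0 \/ dF F q p != 0 -> G p -> covered A.
Proof.
move=> sk pA eA pe spanA qA' q0 Dpq nondeg Gp; apply: (filled_covered spanA).
have l := line_onP (skew_l sk) pA eA.
have [pol|pol] := eqVneq (polar F p e q) 0; last exact: filled_unramified l Dpq pol Gp.
case: nondeg => [|Dqp]; first by rewrite pol eqxx.
have Deq := gauss_nonconstant sk pA eA pe spanA qA' q0 Dpq pol.
have [Fq _ _ _] := line_onP (skew_r sk) qA' qA'.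
exact: (filled_ramified l Fq Dpq pol erefl erefl Deq Dqp Gp).
Qed.

(** On the transversal F is [st (s dF u w + t dF w u)], so [u + w] is the third intersection
    point. *)
Lemma covered_sum A A' u w : covered A -> covered A' -> (u <= A)%MS -> (w <= A')%MS ->
  cubic_eval F u = 0 -> cubic_eval F w = 0 ->
  cubic_eval F (u + w) = 0 -> dF F u w != 0 -> G (u + w).
Proof.
move=> cA cA' uA wA' Fu Fw Fuw Duw.
have u0 : u != 0.
  by apply: contra_neq Duw => ->; rewrite -(scale0r w) dFZl expr0n mul0r.
have w0 : w != 0 by apply: contra_neq Duw => ->; rewrite dF0.
have E : dF F u w + dF F w u = 0.
  by have := cubic_eval2 F u w 1 1; rewrite !scale1r Fuw Fu Fw => ->; ring.
apply: (@SpanPt_scaleE _ (- dF F u w)); first by rewrite oppr_eq0.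
rewrite (_ : _ *: _ = dF F w u *: u - dF F u w *: w); last first.
  by have -> : dF F w u = - dF F u w; [apply/eqP; rewrite -addr_eq0 addrC E | vring].
apply: third_point (cA u uA u0) (cA' w wA' w0) _ _; last by left.
by move=> s t; rewrite cubic_eval2 Fu Fw; ring.
Qed.

(** Each [v] lies on a transversal [u w]. If this lies in S, it is a side of a tangent triangle at
    [u], or one of three concurrent lines when [u] is ramified. *)
Lemma covered_skew_pair A A' v : skew A A' -> covered A -> covered A' ->
  v != 0 -> cubic_eval F v = 0 -> G v.
Proof.
move=> sk cA cA' v0 Fv; have [u [w [uA wA' E]]] := skew_sum v sk; subst v.
have [u0|u0] := eqVneq u 0.
  by move: v0; rewrite u0 add0r; apply: cA'.
have [w0|w0] := eqVneq w 0.
  by move: v0; rewrite w0 addr0; apply: cA.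
have [Fu _ _ _] := line_onP (skew_l sk) uA uA.
have [Fw _ _ _] := line_onP (skew_r sk) wA' wA'.
have [Duw|Duw] := eqVneq (dF F u w) 0; last exact: (covered_sum cA cA' uA wA' Fu Fw Fv Duw).
have Dwu : dF F w u = 0.
  by have := cubic_eval2 F u w 1 1; rewrite !scale1r Fv Fu Fw Duw => ->; ring.
have [e [eA ue spanA]] := line_basis (skew_l sk).1 uA u0.
have l := line_onP (skew_l sk) uA eA; have [_ Fe Due Deu] := l.
have [pol|pol] := eqVneq (polar F u e w) 0; last first.
  have fl := filled_transversal l Duw pol Dwu Fw (cA u uA u0).
  by have := fl 1 1; rewrite !scale1r; apply.
have a0 := gauss_nonconstant sk uA eA ue spanA wA' w0 Duw pol.
have b0 : dF F w e != 0.
  apply/negP => /eqP Dwe; apply: (skew_nonsingular sk w0 Fw).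
    by move=> ? /spanA[x [y ->]]; rewrite dF_lin Dwu Dwe; ring.
  by move=> z zA'; have [] := line_onP (skew_r sk) wA' zA'.
have [a Ea] : exists a, dF F e w = a by eexists.
have [b Eb] : exists b, dF F w e = b by eexists.
rewrite Ea in a0; rewrite Eb in b0.
(* [u + m e + w] lies on the third line through [u] of the section [rt (a t + b r)]; joining it to
   [e] gives [u + w]. *)
pose m := - (b / a).
have m0 : m != 0 by rewrite oppr_eq0 mulf_neq0 ?invr_eq0.
have ev s t r h : h = s *: u + t *: e + r *: w -> cubic_eval F h = r * t * (a * t + b * r).
  by move=> ->; rewrite cubic_eval3 Fu Fe Due Deu Fw Duw Dwu pol Ea Eb; ring.
have GW : G ((1 *: u + m *: e) + w).
  apply: (covered_sum cA cA') => //.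
  - by rewrite addmx_sub ?scalemx_sub.
  - exact: line_eval.
  - by rewrite (ev 1 m 1) ?scale1r //; rewrite /m; field.
  by rewrite dF_quad Duw pol Ea !mulr0 !add0r mulf_neq0 ?expf_neq0.
have e0 : e != 0.
  apply/eqP => e0; have [|_ /eqP] := ue 0 1; first by rewrite e0 scaler0 scale0r addr0.
  by rewrite oner_eq0.
apply: (@SpanPt_scaleE _ a) => //.
rewrite (_ : _ *: _ = a *: ((1 *: u + m *: e) + w) - (a * m) *: e); last by vring.
apply: third_point GW (cA e eA e0) _ _; last by right.
move=> s t; rewrite (ev s (s * m + t) s); last by vring.
by rewrite /m; field.
Qed.

(** The tangent line [p q] at [p] yields [q]. As no transversal through [q] lies in S, [q] is a
    suitable starting point for [covered_line] on A'. *)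
Lemma skew_generates_smooth A A' p q : skew A A' -> covered A ->
  (p <= A)%MS -> p != 0 -> (q <= A')%MS -> q != 0 -> dF F p q = 0 ->
  (forall u, (u <= A)%MS -> u != 0 -> dF F u q = 0 -> dF F q u != 0) ->
  forall v, v != 0 -> cubic_eval F v = 0 -> G v.
Proof.
move=> sk cA pA p0 qA' q0 Dpq smooth_conic v.
have Dqp := smooth_conic p pA p0 Dpq.
have [Fp _ _ _] := line_onP (skew_l sk) pA pA.
have [Fq _ _ _] := line_onP (skew_r sk) qA' qA'.
have Gq : G q.
  apply: (@SpanPt_scaleE _ (- dF F q p)); first by rewrite oppr_eq0.
  rewrite (_ : _ *: _ = 0 *: p - dF F q p *: q); last by vring.
  apply: tangent_point (cA p pA p0) _ _; last by left.
  by move=> s t; rewrite cubic_eval2 Fp Fq Dpq; ring.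
have [u [uA u0 Dqu]] := tangent_on q (skew_l sk).1.
have Duq : dF F u q != 0.
  by apply/negP => /eqP Duq; have := smooth_conic u uA u0 Duq; rewrite Dqu eqxx.
have [e [eA' qe span]] := line_basis (skew_r sk).1 qA' q0.
have cA' := covered_line (skewC sk) qA' eA' qe span uA u0 Dqu (or_intror Duq) Gq.
exact: covered_skew_pair sk cA cA'.
Qed.

(** The nonzero polar value at [p] passes to [u] with a suitable second point [h] of A, so the
    transversal [u q] is a side of a tangent triangle at [u]. *)
Lemma filled_singular_conic A A' p e q u : skew A A' -> covered A ->
  (p <= A)%MS -> (e <= A)%MS ->
  (forall u, (u <= A)%MS -> exists x y, u = x *: p + y *: e) ->
  (q <= A')%MS -> dF F p q = 0 -> polar F p e q != 0 ->
  (u <= A)%MS -> u != 0 -> dF F u q = 0 -> dF F q u = 0 -> filled u q.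
Proof.
move=> sk cA pA eA span qA' Dpq pol uA u0 Duq Dqu.
have [Fq _ _ _] := line_onP (skew_r sk) qA' qA'.
have [h [hA polh]] : exists h, (h <= A)%MS /\ polar F u h q != 0.
  have [x [y Eu]] := span u uA; have [y0|y0] := eqVneq y 0.
    exists e; split=> //; rewrite Eu y0 scale0r addr0 polarC polarZ polarC mulf_neq0 //.
    by apply: contra_neq u0 => x0; rewrite Eu y0 x0 !scale0r addr0.
  exists p; split=> //; rewrite Eu -[X in polar F _ X _]addr0 -(scale0r e) -[X in X + 0 *: e]scale1r.
  by rewrite polar_quad Dpq (_ : _ + _ = y * polar F p e q) ?mulf_neq0 //; ring.
have l := line_onP (skew_l sk) uA hA.
exact: filled_transversal l Duq polh Dqu Fq (cA u uA u0).
Qed.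

Lemma covered_pair_mx u v : filled u v -> covered (pair_mx u v).
Proof. by move=> fl w /sub_pair_mx[s [t ->]]; apply: fl. Qed.

Lemma line_on_pair_mx u v : line u v -> free2 u v -> line_on F (pair_mx u v).
Proof.
move=> l uv; split; first exact: rank_pair_mx.
by move=> w; rewrite mul_pair_mx line_eval.
Qed.

(** A relation between the two transversals splits into components in A and A', which meet only in
    0. *)
Lemma skew_pair_mx A A' u1 u2 w1 w2 : skew A A' ->
  (u1 <= A)%MS -> (u2 <= A)%MS -> (w1 <= A')%MS -> (w2 <= A')%MS ->
  free2 u1 u2 -> free2 w1 w2 -> line u1 w1 -> line u2 w2 ->
  skew (pair_mx u1 w1) (pair_mx u2 w2).
Proof.
move=> sk u1A u2A w1A w2A uu ww l1 l2.
have sep s t s' t' : s *: u1 + t *: w1 = s' *: u2 + t' *: w2 ->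
    [/\ s = 0, t = 0, s' = 0 & t' = 0].
  move=> E; have Z : s *: u1 + (- s') *: u2 = t' *: w2 + (- t) *: w1.
    by apply: (addIr (s' *: u2 + t *: w1)); rewrite [RHS]addrC;
      apply: etrans (etrans (_ : _ = s *: u1 + t *: w1) E) _; vring.
  have Z0 : s *: u1 + (- s') *: u2 = 0.
    apply: (skew_disj sk); first by rewrite addmx_sub ?scalemx_sub.
    by rewrite Z addmx_sub ?scalemx_sub.
  have [-> /eqP] := uu _ _ Z0; rewrite oppr_eq0 => /eqP ->.
  have [] := ww (- t) t'; first by rewrite addrC -Z Z0.
  by move=> /eqP; rewrite oppr_eq0 => /eqP -> ->.
split.
- apply: line_on_pair_mx => // s t E; have [] := sep s t 0 0; last by [].
  by rewrite E !scale0r addr0.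
- apply: line_on_pair_mx => // s t E; have [] := sep 0 0 s t; last by [].
  by rewrite E !scale0r addr0.
apply/eqP; rewrite mxrank_eq0; apply/rowV0P => v.
rewrite sub_capmx => /andP[/sub_pair_mx[s [t ->]] /sub_pair_mx[s' [t']]].
by move/sep => [-> -> _ _]; rewrite !scale0r addr0.
Qed.

(* A point of A admits the tangent process; either some residual conic is smooth and the
   process reaches A', or two residual conics split off transversals of A and A',
   which are then a covered skew pair. *)
Lemma skew_generates A A' p e q : skew A A' ->
  (p <= A)%MS -> (e <= A)%MS -> free2 p e ->
  (forall u, (u <= A)%MS -> exists x y, u = x *: p + y *: e) ->
  (q <= A')%MS -> q != 0 -> dF F p q = 0 ->
  polar F p e q != 0 \/ dF F q p != 0 -> G p ->
  forall v, v != 0 -> cubic_eval F v = 0 -> G v.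
Proof.
move=> sk pA eA pe span qA' q0 Dpq nondeg Gp.
have cA := covered_line sk pA eA pe span qA' q0 Dpq nondeg Gp.
have l := line_onP (skew_l sk) pA eA.
have [[u1 [u1A u10 Du1q Dqu1]]|nsing] := pselect (exists u,
    [/\ (u <= A)%MS, u != 0, dF F u q = 0 & dF F q u = 0]); last first.
  apply: (skew_generates_smooth sk cA pA (SpanPt_neq0 Gp) qA' q0 Dpq).
  by move=> u uA u0 Duq; apply/eqP => Dqu; apply: nsing; exists u.
(* In the ramified case [dF u q] is a nonzero multiple of the squared [e]-coordinate of [u], so [u1]
   would be proportional to [p], against [dF F q p != 0]. *)
have pol : polar F p e q != 0.
  apply/negP => /eqP pol; case: nondeg => [|Dqp]; first by rewrite pol eqxx.
  have Deq := gauss_nonconstant sk pA eA pe span qA' q0 Dpq pol.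
  have [x [y Eu]] := span u1 u1A; move: Du1q Dqu1 u10.
  rewrite Eu dF_quad Dpq pol !mulr0 !add0r => /eqP.
  rewrite mulf_eq0 (negPf Deq) orbF expf_eq0 /= => /eqP ->.
  rewrite scale0r addr0 dFZr => /eqP; rewrite mulf_eq0 (negPf Dqp) orbF => /eqP ->.
  by rewrite scale0r eqxx.
have fl1 := filled_singular_conic sk cA pA eA span qA' Dpq pol u1A u10 Du1q Dqu1.
have [a [b [x [y [c [b0 fr _]]]]]] := tangent_frame l Dpq pol.
have e1A : ((a *: p + b *: e)%R <= A)%MS by rewrite addmx_sub ?scalemx_sub.
move: fr; set e1 := a *: p + b *: e in e1A *; set f1 := _ + 1 *: q => fr.
have [m [z [t [g [c' [m0 z0 t0 _ fr2]]]]]] := frame_other fr.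
move: fr2; set p2 := 1 *: p + m *: e1; set p3 := z *: p + t *: e1 => fr2.
have p2A : (p2 <= A)%MS by rewrite addmx_sub ?scalemx_sub.
have p3A : (p3 <= A)%MS by rewrite addmx_sub ?scalemx_sub.
(* The tangent plane at [p2] misses [q], so it meets A' in a different point [q2]. *)
have Dp2q : dF F p2 q != 0.
  have [_ _ De1f _ _ pol1 _] := fr.
  have [_ _ _ De1p] := line_onP (skew_l sk) pA e1A.
  have [_ _ De1e _] := line_onP (skew_l sk) e1A eA.
  have [_ _ Dpe1 _] := line_onP (skew_l sk) pA e1A.
  have De1q : dF F e1 q = 0.
    by move: De1f; rewrite dF_lin3 De1p De1e !mulr0 !add0r mul1r.
  have pol1q : polar F p e1 q = 1.
    have pe1e : polar F p e1 e = 0.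
      have [_ _ Dpe Dep] := l.
      by rewrite polarCA /e1 polar_lin polar_l polar_r Dpe Dep !mul0rn !mulr0 addr0.
    by rewrite -pol1 polar_lin3 polar_l Dpe1 pe1e mul0rn !mulr0 !add0r mul1r.
  by rewrite dF_quad Dpq De1q pol1q !mulr0 add0r addr0 mul1r mulr1.
have p20 := frame_neq0 fr2.
have [q2 [q2A' q20 Dp2q2]] := tangent_on p2 (skew_r sk).1.
(* This value is the [g]-coordinate of [q2] in the tangent plane at [p2]; if it were zero, [q2]
   would lie on A. *)
have pol2 : polar F p2 p3 q2 != 0.
  apply: contra_neq q20 => pol2; apply: (skew_disj sk) q2A'.
  have [[Fp2 Fp3 D23 D32] D2g D3g _ _ pol23 _] := fr2.
  have [X [Y [Z [T E]]]] := frame_span q2 fr2 Dp2q.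
  have T0 : T = 0.
    apply/eqP; move/eqP: Dp2q2.
    rewrite E -[X *: _ + _ + _]scale1r dF_lin dF_lin3 dF_id Fp2 D23 D2g.
    by rewrite mul0rn !mulr0 !addr0 mulr0 add0r mulf_eq0 (negPf Dp2q) orbF.
  move: pol2; rewrite E T0 scale0r addr0 polar_lin3 polar_l polar_r D23 D32 pol23.
  rewrite !mul0rn !mulr0 !add0r mulr1 => ->.
  by rewrite scale0r addr0 addmx_sub ?scalemx_sub.
have [e2 [e2A _ span2]] := line_basis (skew_l sk).1 p2A p20.
have pol2' : polar F p2 e2 q2 != 0.
  have [x2 [y2 E2]] := span2 p3 p3A; apply: contra_neq pol2 => pol2.
  by rewrite E2 polarCA polar_lin polar_l Dp2q2 polarCA pol2 mul0rn !mulr0 addr0.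
have [[u2 [u2A u20 Du2q2 Dq2u2]]|nsing] := pselect (exists u,
    [/\ (u <= A)%MS, u != 0, dF F u q2 = 0 & dF F q2 u = 0]); last first.
  apply: (skew_generates_smooth sk cA p2A p20 q2A' q20 Dp2q2).
  by move=> u uA u0 Duq; apply/eqP => Dqu; apply: nsing; exists u.
have fl2 := filled_singular_conic sk cA p2A e2A span2 q2A' Dp2q2 pol2' u2A u20 Du2q2 Dq2u2.
have qq : free2 q q2.
  move=> s r E; have /eqP := congr1 (dF F p2) E.
  rewrite dF_lin dF0 Dp2q2 mulr0 addr0 mulf_eq0 (negPf Dp2q) orbF => /eqP s0.
  move/eqP: E; rewrite s0 scale0r add0r scaler_eq0 (negPf q20) orbF => /eqP ->.
  by [].
(* If [u1] and [u2] were the same point, its tangent plane would contain both [q] and [q2], hence A'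
   as well as A. *)
have uu : free2 u1 u2.
  move=> s r E; have [r0|r0] := eqVneq r 0.
    move/eqP: E; rewrite r0 scale0r addr0 scaler_eq0 (negPf u10) orbF => /eqP ->.
    by [].
  have Eu2 : u2 = (- (s / r)) *: u1.
    by apply: (scalerI r0); rewrite scalerA mulrN mulrCA divff // mulr1 scaleNr;
      apply/eqP; rewrite -addr_eq0 addrC E.
  have Du1q2 : dF F u1 q2 = 0.
    move: Du2q2; rewrite Eu2 dFZl => /eqP; rewrite mulf_eq0 expf_eq0 /= => /orP[k0|/eqP//].
    by move: u20; rewrite Eu2 (eqP k0) scale0r eqxx.
  have [h [hA' _ spanA']] := line_basis (skew_r sk).1 qA' q0.
  have Du1h : dF F u1 h = 0.
    have [x' [y' Eq2]] := spanA' q2 q2A'; move: Du1q2.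
    rewrite Eq2 dF_lin Du1q mulr0 add0r => /eqP; rewrite mulf_eq0 => /orP[/eqP y'0|/eqP//].
    have [] := qq x' (- 1); first by rewrite Eq2 y'0; vring.
    by move=> _ /eqP; rewrite oppr_eq0 oner_eq0.
  have [Fu1 _ _ _] := line_onP (skew_l sk) u1A u1A.
  case: (skew_nonsingular sk u10 Fu1).
    by move=> w wA; have [] := line_onP (skew_l sk) u1A wA.
  by move=> w /spanA'[x' [y' ->]]; rewrite dF_lin Du1q Du1h !mulr0 addr0.
have transversal u w : (u <= A)%MS -> (w <= A')%MS -> dF F u w = 0 -> dF F w u = 0 -> line u w.
  move=> uA wA'; have [Fu _ _ _] := line_onP (skew_l sk) uA uA.
  by have [Fw _ _ _] := line_onP (skew_r sk) wA' wA'; split.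
have l1 := transversal _ _ u1A qA' Du1q Dqu1.
have l2 := transversal _ _ u2A q2A' Du2q2 Dq2u2.
move=> v; apply: (covered_skew_pair (skew_pair_mx sk u1A u2A qA' q2A' uu qq l1 l2));
  exact: covered_pair_mx.
Qed.

End Generation.

End Cubic.

(** * The span of a non-Eckardt point *)

Theorem theorem1 (K : fieldType)
  (hK : exists s : seq K, uniq s /\ (4 <= size s)%N)
  (F : cubic K) (hS : smooth_cubic F)
  (M M' : 'M[K]_(2, 4))
  (hl : line_on F M) (hl' : line_on F M')
  (hskew : \rank (M :&: M')%MS = 0%N)
  (P : 'rV[K]_4) (hP0 : P != 0)
  (hP : (P <= M)%MS \/ (P <= M')%MS)
  (hE : ~ eckardt F P) :
  forall x : 'rV[K]_4, x != 0 -> cubic_eval F x = 0 -> SpanPt F P x.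
Proof.
have sk : skew F M M' by [].
wlog PM : M M' hl hl' hskew hP sk / (P <= M)%MS.
  by move=> wl; case: hP => PM; [apply: (wl M M') | apply: (wl M' M)] => //;
    [left | rewrite capmxC | left | apply: skewC].
have [e [eM Pe span]] := line_basis hl.1 PM hP0.
have [q [qM' q0 DPq]] := tangent_on F P hl'.1.
apply: (skew_generates hK hS hP0 sk PM eM Pe span qM' q0 DPq).
  (* If both nondegeneracy conditions failed, the tangent section at [P] would be three lines
     through [P]. *)
  have [pol|pol] := eqVneq (polar F P e q) 0; last by left.
  right; apply/eqP => DqP; apply: hE.
  exact: (eckardt_ramified hK hS sk PM eM Pe span qM' q0 DPq pol DqP).
by apply: Span_base; exists 1; rewrite ?oner_neq0 ?scale1r.
Qed.
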